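(* Let $\mathcal{B}\subset\mathbb{M}_r$ be a matrix ring and $\pi:\mathbb{M}_r\to\mathbb{M}_r$ a positive linear map with $\pi\circ\pi=\pi$ and $\pi(\mathbb{M}_r)=\mathcal{B}$, such that $$\forall Q\in\mathbb{M}_r,\ \forall B\in\mathcal{B}\qquad \pi\left(B[Q-\pi(Q)]+[Q-\pi(Q)]B\right)=0,$$ and assume $A,A',R,S\in\mathcal{B}$, i.e. $(\pi(A),\pi(A'),\pi(R),\pi(S))=(A,A',R,S)$. Then, as maps on $\mathbb{S}_r^+$, $$\pi\circ\mathrm{Ricc}\circ\pi=\mathrm{Ricc}^\pi\circ\pi=\mathrm{Ricc}\circ\pi=\pi\circ\mathrm{Ricc}^\pi\circ\pi,$$ and for any $t\ge0$ $$\pi\circ\phi_t\circ\pi=\pi\circ\varphi^\pi_t\circ\pi=\varphi^\pi_t\circ\pi=\phi_t\circ\pi=\phi^\pi_t\circ\pi .$$ In addition, for any $Q\in\mathbb{S}_r^+$ and $t\ge 0$, $$\phi_t(Q)\le\phi^\pi_t(Q)=\phi_t(\pi(Q))+E_t(\pi(Q))\,(Q-\pi(Q))\,E_t(\pi(Q))' .$$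
   Context: Notation: $\mathbb{M}_r$ = real $r\times r$ matrices, $\mathbb{S}_r^+\subset\mathbb{S}_r$ = symmetric positive semi-definite (resp. symmetric) matrices, $\le$ = Loewner order, $'$ = transpose. A map $\pi$ on $\mathbb{M}_r$ is positive if $\pi(\mathbb{S}_r^+)\subseteq\mathbb{S}_r^+$. Standing setting: $A\in\mathbb{M}_r$, $C$ is a real $r'\times r$ matrix, $R\in\mathbb{S}_r^+$ and $\Sigma\in\mathbb{S}_{r'}^+$ are positive definite, $S:=C'\Sigma^{-1}C$; $(A,R^{1/2})$ is controllable and $(A,C)$ is observable. $\mathrm{Ricc}(Q)=AQ+QA'-QSQ+R$; $\phi_t(Q)$ solves $\partial_t\phi_t(Q)=\mathrm{Ricc}(\phi_t(Q))$, $\phi_0(Q)=Q$. $\mathrm{Ricc}^\pi(Q)=[A-\pi(Q)S]Q+Q[A-\pi(Q)S]'+R+\pi(Q)S\pi(Q)$; $\phi^\pi_t(Q)$ solves $\partial_t\phi^\pi_t(Q)=\mathrm{Ricc}^\pi(\phi^\pi_t(Q))$, $\phi^\pi_0(Q)=Q$. $\varphi^\pi_t(Q)$ is the flow of the projected Riccati equation $\partial_t\varphi^\pi_t(Q)=\pi[\mathrm{Ricc}(\varphi^\pi_t(Q))]$, $\varphi^\pi_0(Q)=Q$. $E_t(Q)$ solves $\partial_tE_t(Q)=(A-\phi_t(Q)S)E_t(Q)$, $E_0(Q)=Id$. *)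

(* Defs.v *)
From HB Require Import structures.
From mathcomp Require Import all_boot all_order all_algebra.
From mathcomp Require Import all_classical all_reals all_analysis.
Import Order.TTheory GRing.Theory Num.Theory numFieldNormedType.Exports.

Set Implicit Arguments.
Unset Strict Implicit.
Unset Printing Implicit Defensive.

Local Open Scope classical_set_scope.
Local Open Scope ring_scope.

Section Matrices.
Variable K : realType.

Definition psd (n : nat) : set 'M[K]_n :=
  [set Q | Q^T = Q /\ forall x : 'cV[K]_n, 0 <= (x^T *m Q *m x) 0 0].

Definition posdef (n : nat) : set 'M[K]_n :=
  [set Q | Q^T = Q /\ forall x : 'cV[K]_n, x != 0 -> 0 < (x^T *m Q *m x) 0 0].

Definition loewner_le (n : nat) (P Q : 'M[K]_n) : Prop := psd (Q - P).

(* The symmetric square root Q^{1/2}; it exists and is unique when [psd Q]. *)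
Definition psd_sqrt (n : nat) (Q : 'M[K]_n) : 'M[K]_n :=
  xget 0 [set H | psd H /\ H *m H = Q].

(* Kalman rank conditions *)
Definition controllable (n m : nat) (A : 'M[K]_n) (B : 'M[K]_(n, m)) : Prop :=
  \rank (\mxrow_(i < n) (A ^+ i *m B)) = n.

Definition observable (n m : nat) (A : 'M[K]_n) (C : 'M[K]_(m, n)) : Prop :=
  \rank (\mxcol_(i < n) (C *m A ^+ i)) = n.

(* A subring of the n x n matrices. Membership of the identity is not imposed;
   it is automatic for a linear subspace containing a positive definite matrix,
   by Cayley-Hamilton. *)
Definition matrix_ring (n : nat) (B : set 'M[K]_n) : Prop :=
  [/\ B 0, forall X Y, B X -> B Y -> B (X - Y) &
      forall X Y, B X -> B Y -> B (X *m Y)].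

Definition positive_map (n : nat) (p : 'M[K]_n -> 'M[K]_n) : Prop :=
  forall Q, psd Q -> psd (p Q).

Definition ricc (n : nat) (A R S Q : 'M[K]_n) : 'M[K]_n :=
  A *m Q + Q *m A^T - Q *m S *m Q + R.

Definition ricc_pi (n : nat) (p : 'M[K]_n -> 'M[K]_n) (A R S Q : 'M[K]_n) :
    'M[K]_n :=
  (A - p Q *m S) *m Q + Q *m (A - p Q *m S)^T + R + p Q *m S *m p Q.

(* X solves X'(t) = F t (X t) on [0, +oo[ with X 0 = X0. At the endpoint 0 only
   right-continuity is required: for continuous F the right derivative at 0 is
   then F 0 X0 by the mean value theorem. Values X t with t < 0 are irrelevant. *)
Definition solves_ode (n : nat) (F : K -> 'M[K]_n -> 'M[K]_n) (X0 : 'M[K]_n)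
    (X : K -> 'M[K]_n) : Prop :=
  [/\ X 0 = X0, X x @[x --> 0^'+] --> X 0 &
      forall t : K, 0 < t -> is_derive t 1 X (F t (X t))].

(* [phi t Q] is the value at time t of a solution of X' = F X issued from Q, for
   every initial condition Q in D. *)
Definition flow_on (n : nat) (D : set 'M[K]_n) (F : 'M[K]_n -> 'M[K]_n)
    (phi : K -> 'M[K]_n -> 'M[K]_n) : Prop :=
  forall Q, D Q -> solves_ode (fun _ => F) Q (phi ^~ Q).

End Matrices.

(* Main.v *)
(* The flow identities follow from uniqueness for the Riccati equations, because
   Ricc preserves the range B of pi. For the last formula one has to see that
   W_t = E_t (Q - pi Q) E_t' stays in ker pi, that is, that pi (M W + W M') = 0
   for W symmetric in ker pi and M, M' in B. The hypothesis gives this with M in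
   place of M', which leaves the commutators y = pi [K, W] with K in B
   antisymmetric. Iterating the hypothesis shows that pi [[B1, B2], W] = 0, hence
   [K, C] y + y [K, C] = 0 for all C in B, and C = [K, y] gives [K, y] = 0 after
   taking a trace. Then pi [P(K), W] = P'(K) y for every polynomial P; for the
   minimal polynomial of K, which is separable since K is normal, P'(K) is
   invertible and therefore y = 0.
   The Loewner inequality holds because D = phi^pi_t(Q) - phi_t(Q) solves
   D' = M D + D M' + G with G positive semi-definite and D_0 = 0, so that
   E_t^-1 D_t E_t^-T is nondecreasing. *)
Require Import Defs.
From HB Require Import structures.
From mathcomp Require Import all_boot all_order all_algebra perm separable.
From mathcomp Require Import all_classical all_reals all_analysis.
From mathcomp Require Import ring zify.
Import Order.TTheory GRing.Theory Num.Theory numFieldNormedType.Exports.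

Set Implicit Arguments.
Unset Strict Implicit.
Unset Printing Implicit Defensive.

Local Open Scope classical_set_scope.
Local Open Scope ring_scope.

(** * Jordan-equivariant projections *)

Lemma mxDE (V : zmodType) m n (X Y : 'M[V]_(m, n)) i j : (X + Y) i j = X i j + Y i j.
Proof. by rewrite mxE. Qed.
Lemma mxNE (V : zmodType) m n (X : 'M[V]_(m, n)) i j : (- X) i j = - X i j.
Proof. by rewrite mxE. Qed.

(* Noncommutative identities become linear ones, entry by entry, once all
   products are expanded. *)
Ltac mx_ring :=
  rewrite ?(mulmxDl, mulmxDr, mulmxN, mulNmx, opprD, opprK) ?mulmxA;
  let i := fresh in let j := fresh in
  apply/matrixP => i j; rewrite ?(mxDE, mxNE); ring.

Lemma tr_mulmxtr_eq0 (F : realFieldType) m n (N : 'M[F]_(m, n)) :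
  \tr (N *m N^T) = 0 -> N = 0.
Proof.
move=> /eqP; rewrite psumr_eq0 => [/allP h|i _]; last first.
  by rewrite mxE sumr_ge0 // => j _; rewrite mxE -expr2 sqr_ge0.
apply/matrixP => i j; have /= := h i (mem_index_enum i).
rewrite !mxE psumr_eq0 => [/allP/(_ j (mem_index_enum j))|k _].
  by rewrite /= mxE -expr2 sqrf_eq0 => /eqP.
by rewrite mxE -expr2 sqr_ge0.
Qed.

(** Normality turns [N N^T (N N^T)^T] into [N N N^T N^T = 0]. The trace criterion, a sum of squares
    of entries, then applies to [N N^T] first and to [N] next. *)
Lemma normal_sqr_eq0 (F : realFieldType) n (N : 'M[F]_n) :
  N^T *m N = N *m N^T -> N *m N = 0 -> N = 0.
Proof.
move=> hN N2; suff h : N *m N^T = 0 by apply: tr_mulmxtr_eq0; rewrite h mxtrace0.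
apply: tr_mulmxtr_eq0; rewrite trmx_mul trmxK.
by rewrite mulmxA -(mulmxA N) hN mulmxA N2 !mul0mx mxtrace0.
Qed.

(** * Polynomials in an antisymmetric matrix *)

Section Antisymmetric.
Variables (F : realFieldType) (n : nat) (K : 'M[F]_n.+1).
Hypothesis antiK : K^T = - K.

Lemma horner_mx_comm (P Q : {poly F}) :
  horner_mx K P *m horner_mx K Q = horner_mx K Q *m horner_mx K P.
Proof. by rewrite !mulmxE -!rmorphM mulrC. Qed.

Lemma horner_mx_tr_anti (P : {poly F}) : (horner_mx K P)^T = horner_mx K (P \Po (- 'X)).
Proof.
elim/poly_ind: P => [|P c IH]; first by rewrite comp_poly0 !rmorph0 trmx0.
rewrite comp_polyD comp_polyM comp_polyX comp_polyC !rmorphD !rmorphM /= linearD /=.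
rewrite -mulmxE trmx_mul IH.
rewrite !horner_mx_C tr_scalar_mx (raddfN (horner_mx K)) /= horner_mx_X antiK.
rewrite -[in - K](horner_mx_X K) mulNmx mulmxN.
by rewrite horner_mx_comm.
Qed.

(** [P(K)] is normal, since its transpose [P(-K)] is again a polynomial in [K]. *)
Lemma horner_mx_sqr_eq0 (P : {poly F}) :
  horner_mx K (P * P) = 0 -> horner_mx K P = 0.
Proof.
rewrite rmorphM /= => h; apply: normal_sqr_eq0 => //.
by rewrite horner_mx_tr_anti horner_mx_comm.
Qed.

(** If the minimal polynomial is [h q^2], then [(q h)^2] annihilates [K], hence so does [q h], and
    minimality forces [q] to be constant. *)
Lemma separable_mxminpoly_anti : separable_poly (mxminpoly K).
Proof.
have m0 : mxminpoly K != 0 by exact: monic_neq0 (mxminpoly_monic K).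
have small (q : {poly F}) : q * q %| mxminpoly K -> size q = 1%N.
  move=> /dvdpP[h hm].
  have q0 : q != 0 by apply: contra_neq m0; rewrite hm => ->; rewrite !mulr0.
  have h0 : h != 0 by apply: contra_neq m0; rewrite hm => ->; rewrite !mul0r.
  have : horner_mx K (q * h) = 0.
    apply: horner_mx_sqr_eq0.
    have -> : q * h * (q * h) = h * mxminpoly K by rewrite hm; ring.
    by rewrite rmorphM /= mx_root_minpoly mulr0.
  move/mxminpoly_min/dvdp_leq; rewrite mulf_neq0 // => /(_ isT).
  rewrite hm !size_mul ?mulf_neq0 //.
  by move: q0 h0; rewrite -!size_poly_gt0; move: (size q) (size h) => a b; lia.
(* The square of [gcdp u v] divides [u * v], so squarefreeness yields coprimality. *)
apply/separable_polyP; split=> [u v uv|u _ su].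
  rewrite /coprimep; apply/eqP/small.
  by apply: dvdp_trans uv; apply: dvdp_mul; rewrite ?dvdp_gcdl ?dvdp_gcdr.
have u0 : u != 0 by rewrite -size_poly_gt0 ltnW.
(* The top coefficient of the derivative is the degree of [u] times its leading coefficient, nonzero
   in characteristic 0. *)
apply/eqP => /(congr1 (fun q : {poly F} => q`_(size u).-2)).
rewrite coef_deriv coef0 prednK ?ltn_predRL // -lead_coefE => /eqP.
by rewrite mulrn_eq0 lead_coef_eq0 (negbTE u0) orbF -leqn0 leqNgt ltn_predRL su.
Qed.

End Antisymmetric.

(** * Commutators between the range and the kernel of the projection *)

Section JordanProjection.
Variables (F : realFieldType) (n : nat) (p : {linear 'M[F]_n -> 'M[F]_n}).
Hypothesis p_idem : forall X, p (p X) = p X.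
Hypothesis p_mul : forall X Y, p X = X -> p Y = Y -> p (X *m Y) = X *m Y.
Hypothesis p_proj : forall X B, p B = B ->
  p (B *m (X - p X) + (X - p X) *m B) = 0.

(** Of the two parts of [X], [X - p X] is removed by [p_proj], and [p X] has products with [B] that
    stay in the range of [p]. *)
Lemma proj_jordan B X : p B = B ->
  p (B *m X + X *m B) = B *m p X + p X *m B.
Proof.
move=> pB.
have -> : B *m X + X *m B =
    (B *m (X - p X) + (X - p X) *m B) + (B *m p X + p X *m B) by mx_ring.
by rewrite linearD p_proj // add0r linearD /= !p_mul.
Qed.

(** With [X o Y = X Y + Y X], the double commutator [[[B, C], W]] equals
    [B o (C o W) - C o (B o W)], and [proj_jordan] applies twice to each term. *)
Lemma proj_comm_comm B C W : p B = B -> p C = C -> p W = 0 ->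
  p ((B *m C - C *m B) *m W - W *m (B *m C - C *m B)) = 0.
Proof.
move=> pB pC pW.
have -> : (B *m C - C *m B) *m W - W *m (B *m C - C *m B) =
  (B *m (C *m W + W *m C) + (C *m W + W *m C) *m B)
  - (C *m (B *m W + W *m B) + (B *m W + W *m B) *m C) by mx_ring.
by rewrite linearB /= !proj_jordan // pW !(mulmx0, mul0mx, addr0, subr0).
Qed.

(** The commutator with [W] is a derivation of the Jordan product [o]. For [G = [K, C]], where
    [[K^2, C] = K o G], this reads [G o [K, W] = [[K^2, C], W] - K o [G, W]], and [p] kills both
    terms on the right. *)
Lemma proj_comm_jordan K C W : p K = K -> p C = C -> p W = 0 ->
  (K *m C - C *m K) *m p (K *m W - W *m K)
    + p (K *m W - W *m K) *m (K *m C - C *m K) = 0.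
Proof.
move=> pK pC pW; set G := K *m C - C *m K.
have pKC : p (K *m C) = K *m C by exact: p_mul.
have pCK : p (C *m K) = C *m K by exact: p_mul.
have pG : p G = G by rewrite linearB /= pKC pCK.
rewrite -proj_jordan //.
have -> : G *m (K *m W - W *m K) + (K *m W - W *m K) *m G =
  ((K *m K *m C - C *m (K *m K)) *m W - W *m (K *m K *m C - C *m (K *m K)))
  - (K *m (G *m W - W *m G) + (G *m W - W *m G) *m K) by rewrite /G; mx_ring.
rewrite linearB /= proj_comm_comm ?p_mul // proj_jordan // proj_comm_comm //.
by rewrite mulmx0 mul0mx addr0 subr0.
Qed.

Lemma proj_comm_commute K W : p K = K -> K^T = - K -> p W = 0 ->
    (p (K *m W - W *m K))^T = p (K *m W - W *m K) ->
  K *m p (K *m W - W *m K) = p (K *m W - W *m K) *m K.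
Proof.
move=> pK antiK pW; set Y := p _ => symY.
have pY : p Y = Y by rewrite p_idem.
pose N := K *m Y - Y *m K.
have pN : p N = N by rewrite linearB /= !p_mul.
suff /eqP : N = 0 by rewrite subr_eq0 => /eqP.
have symN : N^T = N.
  by rewrite linearB /= !trmx_mul symY antiK mulmxN mulNmx opprK addrC.
apply: tr_mulmxtr_eq0; rewrite symN.
(* Here [proj_comm_jordan] is taken at [C := N]. Cyclicity of the trace turns it into
   [tr (N N) = 0], where [N] is symmetric. *)
have : \tr ((K *m N - N *m K) *m Y + Y *m (K *m N - N *m K)) = 0.
  by rewrite proj_comm_jordan // mxtrace0.
rewrite mxtraceD [X in _ + X]mxtrace_mulC mulmxBl linearB /=.
have -> : \tr (K *m N *m Y) = \tr (N *m (Y *m K)).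
  by rewrite -mulmxA mxtrace_mulC mulmxA.
rewrite -(mulmxA N) -linearB /= -mulmxBr -opprB -/N mulmxN linearN /= -opprD.
by move/eqP; rewrite oppr_eq0 -mulr2n mulrn_eq0 => /eqP.
Qed.

End JordanProjection.

(** * Polynomial calculus for projected commutators *)

Section ProjectionCommutator.
Variables (F : realFieldType) (n : nat) (p : {linear 'M[F]_n.+1 -> 'M[F]_n.+1}).
Hypothesis p_idem : forall X, p (p X) = p X.
Hypothesis p_mul : forall X Y, p X = X -> p Y = Y -> p (X *m Y) = X *m Y.
Hypothesis p_proj : forall X B, p B = B ->
  p (B *m (X - p X) + (X - p X) *m B) = 0.

(** The factor ['X] leaves out the constant term, because the identity matrix is not assumed to lie
    in the range of [p]. *)
Lemma proj_horner_mul K (P : {poly F}) : p K = K ->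
  p (horner_mx K (P * 'X)) = horner_mx K (P * 'X).
Proof.
move=> pK; elim/poly_ind: P => [|P c IH]; first by rewrite mul0r rmorph0 linear0.
rewrite rmorphM rmorphD /= horner_mx_X horner_mx_C -mulmxE mulmxDl mul_scalar_mx.
by rewrite linearD linearZ /= pK p_mul.
Qed.

(** The constant term only contributes a multiple of [X], which passes through [p] by linearity;
    [proj_jordan] handles the rest. *)
Lemma proj_jordan_horner K (P : {poly F}) X : p K = K ->
  p (horner_mx K P *m X + X *m horner_mx K P)
    = horner_mx K P *m p X + p X *m horner_mx K P.
Proof.
move=> pK; elim/poly_ind: P => [|P c _].
  by rewrite rmorph0 !mul0mx !mulmx0 addr0 linear0.
rewrite rmorphD /= horner_mx_C !mulmxDl !mulmxDr !mul_scalar_mx !mul_mx_scalar.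
rewrite !(addrACA _ (c *: _)) linearD /= proj_jordan ?proj_horner_mul //.
by rewrite linearD /= !linearZ.
Qed.

(** Induction through the Leibniz rule [2 [Q K, W] = Q o [K, W] + K o [Q, W]] for commuting [Q] and
    [K]. After projection the Jordan products become plain doubles, as [p [K, W]] commutes with
    every polynomial in [K]. *)
Lemma proj_comm_horner K W (P : {poly F}) : p K = K -> K^T = - K -> p W = 0 ->
    (p (K *m W - W *m K))^T = p (K *m W - W *m K) ->
  p (horner_mx K P *m W - W *m horner_mx K P)
    = horner_mx K P^`() *m p (K *m W - W *m K).
Proof.
move=> pK antiK pW symY.
have KY := proj_comm_commute p_idem p_mul p_proj pK antiK pW symY.
have comY Q : horner_mx K Q *m p (K *m W - W *m K) = p (K *m W - W *m K) *m horner_mx K Q.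
  elim/poly_ind: Q => [|Q c IH]; first by rewrite rmorph0 mul0mx mulmx0.
  rewrite rmorphD rmorphM /= horner_mx_X horner_mx_C -mulmxE mulmxDl mulmxDr.
  by rewrite -mulmxA KY mulmxA IH -mulmxA scalar_mxC.
elim/poly_ind: P => [|P c IH]; first by rewrite deriv0 rmorph0 !mul0mx mulmx0 subrr linear0.
rewrite derivD derivC addr0 derivM derivX mulr1 !rmorphD !rmorphM /= horner_mx_X horner_mx_C.
rewrite -!mulmxE; set Q := horner_mx K P; set Q' := horner_mx K P^`().
have QK : Q *m K = K *m Q.
  by rewrite /Q -{2 3}(horner_mx_X K) horner_mx_comm.
have dbl (Z : 'M[F]_n.+1) Z' : Z *+ 2 = Z' *+ 2 -> Z = Z'.
  by move/eqP; rewrite -subr_eq0 -mulrnBl -scaler_nat scaler_eq0 pnatr_eq0 subr_eq0 => /eqP.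
have -> : (Q *m K + c%:M) *m W - W *m (Q *m K + c%:M) = Q *m K *m W - W *m (Q *m K).
  by rewrite mulmxDl mulmxDr scalar_mxC; mx_ring.
apply: dbl; rewrite -linearMn /=.
have -> : (Q *m K *m W - W *m (Q *m K)) *+ 2 =
   (Q *m (K *m W - W *m K) + (K *m W - W *m K) *m Q)
   + (K *m (Q *m W - W *m Q) + (Q *m W - W *m Q) *m K).
  have -> : (Q *m K *m W - W *m (Q *m K)) *+ 2 =
    (Q *m K *m W - W *m (Q *m K)) + (K *m Q *m W - W *m (K *m Q)) by rewrite mulr2n QK.
  by mx_ring.
rewrite linearD /= proj_jordan_horner // proj_jordan // IH -comY.
have KQ' : K *m Q' = Q' *m K by rewrite /Q' -{1 4}(horner_mx_X K) horner_mx_comm.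
rewrite -/Q -/Q'; move: (p _) KY => Y KY.
by rewrite -(mulmxA Q') -KY !mulmxA KQ' mulr2n; mx_ring.
Qed.

Lemma proj_comm_anti_eq0_succ K W : p K = K -> K^T = - K -> p W = 0 ->
    (p (K *m W - W *m K))^T = p (K *m W - W *m K) ->
  p (K *m W - W *m K) = 0.
Proof.
move=> pK antiK pW symY.
have := proj_comm_horner (mxminpoly K) pK antiK pW symY.
rewrite mx_root_minpoly mul0mx mulmx0 subrr linear0 => /esym dY.
(* Evaluated at [K], the Bezout relation between the minimal polynomial and its derivative makes
   [v(K)] a left inverse of the factor in [dY]. *)
have := separable_mxminpoly_anti antiK; rewrite unlock => /Bezout_eq1_coprimepP[[u v] /= uv1].
rewrite -[LHS]mul1mx -[1%:M](horner_mx_C K 1) -[1%:P]uv1.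
rewrite rmorphD !rmorphM /= mx_root_minpoly mulr0 add0r -mulmxE.
by rewrite -mulmxA dY mulmx0.
Qed.

End ProjectionCommutator.

(** * Projection of the Lyapunov operator *)

Section LyapunovProjection.
Variables (K : realType) (n : nat) (p : {linear 'M[K]_n -> 'M[K]_n}).
Hypothesis p_pos : positive_map p.

Lemma psd_mulmx_tr m (v : 'M[K]_(n, m)) : psd (v *m v^T).
Proof.
split=> [|x]; first by rewrite trmx_mul trmxK.
rewrite mulmxA -mulmxA -{1}(trmxK v) -trmx_mul mxE sumr_ge0 // => i _.
by rewrite mxE -expr2 sqr_ge0.
Qed.

(** By polarization [E_ij + E_ji] is a combination of matrices [v v^T], whose images are positive
    semi-definite and so symmetric. These sums span the symmetric matrices. *)
Lemma positive_map_sym Q : Q^T = Q -> (p Q)^T = p Q.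
Proof.
move=> symQ.
have symE i j : (p (delta_mx i j + delta_mx j i))^T = p (delta_mx i j + delta_mx j i).
  pose e k : 'cV[K]_n := delta_mx k 0.
  have -> : delta_mx i j + delta_mx j i =
      (e i + e j) *m (e i + e j)^T - e i *m (e i)^T - e j *m (e j)^T.
    rewrite [(e i + e j)^T]linearD /= mulmxDl !mulmxDr !trmx_delta !mul_delta_mx.
    by apply/matrixP => k l; rewrite ?(mxDE, mxNE); ring.
  rewrite !linearB /=.
  by rewrite !(proj1 (p_pos (psd_mulmx_tr _))).
have : (p (Q + Q^T))^T = p (Q + Q^T).
  rewrite [Q in Q + _]matrix_sum_delta [Q in _ + Q^T]matrix_sum_delta.
  rewrite !linear_sum -big_split /= !linear_sum; apply: eq_bigr => i _.
  rewrite !linear_sum -big_split /= !linear_sum; apply: eq_bigr => j _.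
  by rewrite linearZ /= trmx_delta -scalerDr !linearZ /= symE.
rewrite symQ -mulr2n !linearMn /= => /eqP.
by rewrite -subr_eq0 -mulrnBl -scaler_nat scaler_eq0 pnatr_eq0 subr_eq0 => /eqP.
Qed.

Hypothesis p_idem : forall X, p (p X) = p X.
Hypothesis p_mul : forall X Y, p X = X -> p Y = Y -> p (X *m Y) = X *m Y.
Hypothesis p_proj : forall X B, p B = B ->
  p (B *m (X - p X) + (X - p X) *m B) = 0.

Lemma proj_comm_anti_eq0 Z W : p Z = Z -> Z^T = - Z -> W^T = W -> p W = 0 ->
  p (Z *m W - W *m Z) = 0.
Proof.
move=> pZ antiZ symW pW.
have : (p (Z *m W - W *m Z))^T = p (Z *m W - W *m Z).
  apply: positive_map_sym.
  by rewrite linearB /= !trmx_mul symW antiZ mulmxN mulNmx opprK addrC.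
(* Evaluating polynomials at a matrix requires size [m.+1]; in size 0 there is only one matrix. *)
case: n p p_idem p_mul p_proj Z W pZ antiZ {symW} pW => [|m] q qI qM qP Z W qZ aZ qW.
  by move=> _; apply/matrixP => - [].
exact: proj_comm_anti_eq0_succ.
Qed.

(** For [D = W - p W], twice [M D + D M^T] is the Jordan product of [D] with [M + M^T] plus its
    commutator with the antisymmetric [M - M^T]; [p] kills each. *)
Lemma proj_lyapunov M W : p M = M -> p M^T = M^T -> W^T = W ->
  p (M *m W + W *m M^T) = M *m p W + p W *m M^T.
Proof.
move=> pM pM' symW; set D := W - p W.
have symD : D^T = D by rewrite linearB /= symW positive_map_sym.
have pD : p D = 0 by rewrite linearB /= p_idem subrr.
suff pMD : p (M *m D + D *m M^T) = 0.
  have -> : M *m W + W *m M^T =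
    (M *m D + D *m M^T) + (M *m p W + p W *m M^T) by rewrite /D; mx_ring.
  by rewrite linearD /= pMD add0r linearD /= !p_mul.
suff /eqP : p (M *m D + D *m M^T) *+ 2 = 0.
  by rewrite -scaler_nat scaler_eq0 pnatr_eq0 => /eqP.
rewrite -linearMn /=.
have -> : (M *m D + D *m M^T) *+ 2 =
  ((M + M^T) *m D + D *m (M + M^T)) + ((M - M^T) *m D - D *m (M - M^T)).
  by rewrite mulr2n; mx_ring.
have pMM : p (M + M^T) = M + M^T by rewrite linearD /= pM pM'.
have pMB : p (M - M^T) = M - M^T by rewrite linearB /= pM pM'.
rewrite [LHS]linearD /= (proj_jordan p_idem p_mul p_proj) // pD mulmx0 mul0mx addr0 add0r.
by rewrite proj_comm_anti_eq0 // linearB /= trmxK opprB.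
Qed.

End LyapunovProjection.

(** * Differential equations on the half-line *)

Section RightContinuousPrimitive.
Variable K : realType.
Implicit Types f g df dg u du : K -> K.

(** The regularity of [solves_ode] in scalar form: just enough for the mean value theorem on
    [[a, b]] with [0 <= a]. Values of [df] outside the open half-line are unconstrained. *)
Definition primitive_ge0 f df :=
  f x @[x --> 0^'+] --> f 0 /\ forall t : K, 0 < t -> is_derive t 1 f (df t).

Lemma eq_primitive_ge0 f g df dg : f =1 g -> df =1 dg ->
  primitive_ge0 f df -> primitive_ge0 g dg.
Proof. by move=> /funext -> /funext ->. Qed.

Lemma primitive_ge0_cst (c : K) : primitive_ge0 (fun=> c) (fun=> 0).
Proof. by split=> [|t _]; [exact: cvg_cst|exact: is_derive_cst]. Qed.

Lemma primitive_ge0D f g df dg : primitive_ge0 f df -> primitive_ge0 g dg ->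
  primitive_ge0 (fun t => f t + g t) (fun t => df t + dg t).
Proof.
move=> [f0 fd] [g0 gd]; split=> [|t t0]; first exact: cvgD.
by have := fd t t0; have := gd t t0 => ? ?; exact: is_deriveD.
Qed.

Lemma primitive_ge0N f df : primitive_ge0 f df ->
  primitive_ge0 (fun t => - f t) (fun t => - df t).
Proof.
move=> [f0 fd]; split=> [|t t0]; first exact: cvgN.
by have := fd t t0 => ?; exact: is_deriveN.
Qed.

Lemma primitive_ge0M f g df dg : primitive_ge0 f df -> primitive_ge0 g dg ->
  primitive_ge0 (fun t => f t * g t) (fun t => df t * g t + f t * dg t).
Proof.
move=> [f0 fd] [g0 gd]; split=> [|t t0]; first exact: cvgM.
have := fd t t0; have := gd t t0 => ? ?.
by apply: is_derive_eq; rewrite addrC [df t * _]mulrC.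
Qed.

Lemma primitive_ge0_sum I (r : seq I) (f df : I -> K -> K) :
  (forall i, primitive_ge0 (f i) (df i)) ->
  primitive_ge0 (fun t => \sum_(i <- r) f i t) (fun t => \sum_(i <- r) df i t).
Proof.
move=> h; elim: r => [|i r IH].
  by apply: eq_primitive_ge0 (primitive_ge0_cst 0) => t; rewrite big_nil.
by apply: eq_primitive_ge0 (primitive_ge0D (h i) IH) => t; rewrite big_cons.
Qed.

(** The derivative is left unnamed: it serves determinants and inverses, where a usable formula
    comes later from differentiating [F *m E = 1]. *)
Lemma primitive_ge0_prod I (r : seq I) (f df : I -> K -> K) :
  (forall i, primitive_ge0 (f i) (df i)) ->
  exists d, primitive_ge0 (fun t => \prod_(i <- r) f i t) d.
Proof.
move=> h; elim: r => [|i r [d IH]].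
  exists (fun=> 0).
  by apply: eq_primitive_ge0 (primitive_ge0_cst 1) => // t; rewrite big_nil.
eexists; apply: eq_primitive_ge0 (primitive_ge0M (h i) IH) => t; last reflexivity.
by rewrite big_cons.
Qed.

Lemma primitive_ge0V f df : (forall t : K, 0 <= t -> f t != 0) ->
  primitive_ge0 f df -> exists d, primitive_ge0 (fun t => (f t)^-1) d.
Proof.
move=> fn0 [f0 fd]; exists (fun t => 'D_1 (fun t => (f t)^-1) t); split=> [|t t0].
  by apply: cvgV => //; exact: fn0.
by apply/derivableP/derivableV; [exact/fn0/ltW|have [] := fd t t0].
Qed.

Lemma primitive_ge0_expR (c : K) :
  primitive_ge0 (fun t => expR (c * t)) (fun t => c * expR (c * t)).
Proof.
split=> [|t _].
  apply: cvg_at_right_filter; apply: (continuous_comp (f := fun t => c * t)).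
    exact: mulrl_continuous.
  exact: continuous_expR.
have h : is_derive t 1 (fun t => c * t) c.
  by apply: is_derive_eq; rewrite [LHS]mulr1.
by apply: is_derive_eq; rewrite mulrC.
Qed.

Lemma primitive_ge0_continuous f df a b : primitive_ge0 f df -> 0 <= a -> a < b ->
  {within `[a, b], continuous f}.
Proof.
move=> [f0 fd] a0 ab.
have cf t : 0 < t -> {for t, continuous f}.
  by move=> t0; apply/differentiable_continuous/derivable1_diffP; have [] := fd t t0.
apply/(continuous_within_itvP _ ab); split.
- by move=> x; rewrite in_itv /= => /andP[ax _]; apply: cf; exact: le_lt_trans ax.
- move: a0; rewrite le_eqVlt => /predU1P[<- //|a0].
  by apply: cvg_at_right_filter; exact: cf.
- by apply: cvg_at_left_filter; apply: cf; exact: le_lt_trans ab.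
Qed.

Lemma primitive_ge0_homo f df a b : primitive_ge0 f df -> 0 <= a -> a <= b ->
  (forall t : K, a < t < b -> 0 <= df t) -> f a <= f b.
Proof.
move=> fdf a0; rewrite le_eqVlt => /predU1P[-> //|ab] df0.
have [x|c] := @MVT _ f df a b ab _ (primitive_ge0_continuous fdf a0 ab).
  by rewrite in_itv /= => /andP[ax _]; apply: fdf.2; exact: le_lt_trans ax.
rewrite in_itv /= => cab e.
by rewrite -subr_ge0 e mulr_ge0 ?df0 // subr_ge0 ltW.
Qed.

Lemma primitive_ge0_bounded f df T : primitive_ge0 f df ->
  exists2 M, 0 <= M & forall t : K, 0 <= t <= T -> `|f t| <= M.
Proof.
move=> fdf; have [T0|T0] := leP T 0.
  exists `|f 0| => // t /andP[t0 tT].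
  by have -> : t = 0 by apply/le_anti; rewrite t0 (le_trans tT).
have cf := primitive_ge0_continuous fdf (lexx 0) T0.
have [a _ amax] := EVT_max (ltW T0) cf.
have [b _ bmin] := EVT_min (ltW T0) cf.
exists (`|f a| + `|f b|) => [|t tT]; first by rewrite addr_ge0.
have /amax fa : t \in `[0, T] by rewrite in_itv.
have /bmin fb : t \in `[0, T] by rewrite in_itv.
rewrite ler_norml; apply/andP; split.
  apply: le_trans fb; rewrite lerNl (le_trans (ler_norm _)) // normrN.
  by rewrite lerDr.
by apply: (le_trans fa); rewrite (le_trans (ler_norm _)) // lerDl.
Qed.

(** [u(t) exp(L t)] is nondecreasing and [u(t) exp(- L t)] nonincreasing, which settles the times
    before and after [a]. The forward direction serves uniqueness, the backward one invertibility of
    fundamental solutions. *)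
Lemma gronwall_eq0 u du L T a : primitive_ge0 u du ->
  (forall t : K, 0 <= u t) -> (forall t : K, 0 < t < T -> `|du t| <= L * u t) ->
  0 <= a <= T -> u a = 0 -> forall t : K, 0 <= t <= T -> u t = 0.
Proof.
move=> udu u0 hdu /andP[a0 aT] ua0 t /andP[t0 tT].
apply/le_anti; rewrite u0 andbT.
have [ta|/ltW at_] := leP t a.
  have /primitive_ge0_homo := primitive_ge0M udu (primitive_ge0_expR L).
  move=> /(_ t a t0 ta); rewrite ua0 mul0r pmulr_lle0 ?expR_gt0 //; apply.
  move=> s /andP[ts sa]; rewrite mulrA -mulrDl mulr_ge0 ?expR_ge0 //.
  have : `|du s| <= L * u s by rewrite hdu // (le_lt_trans t0) //= (lt_le_trans sa).
  by rewrite ler_norml => /andP[+ _]; rewrite lerNl -subr_ge0 opprK addrC [L * _]mulrC.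
have /primitive_ge0_homo := primitive_ge0N (primitive_ge0M udu (primitive_ge0_expR (- L))).
move=> /(_ a t a0 at_); rewrite ua0 mul0r oppr0 oppr_ge0 pmulr_lle0 ?expR_gt0 //; apply.
move=> s /andP[ts sa]; rewrite mulrA -mulrDl -mulNr mulr_ge0 ?expR_ge0 //.
have : `|du s| <= L * u s by rewrite hdu // (le_lt_trans a0) //= (lt_le_trans sa).
rewrite ler_norml => /andP[_]; rewrite -subr_ge0.
by rewrite opprD mulrN opprK [u s * L]mulrC addrC.
Qed.

End RightContinuousPrimitive.

(** * The maximum norm of matrices *)

Section MatrixNorm.
Variable K : realType.

Lemma ler_mx_entry_norm m n (X : 'M[K]_(m, n)) i j : `|X i j| <= `|X|.
Proof. by rewrite [leRHS]/Num.Def.normr /= mx_normrE; exact: (le_bigmax _ _ (i, j)). Qed.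

Lemma mx_norm_le m n (X : 'M[K]_(m, n)) c : 0 <= c ->
  (forall i j, `|X i j| <= c) -> `|X| <= c.
Proof.
move=> c0 Xc; rewrite [leLHS]/Num.Def.normr /= mx_normrE.
by apply: bigmax_le => // i _; exact: Xc.
Qed.

(** The maximum norm is not submultiplicative: [k] counts the terms in one entry of the product. *)
Lemma mx_norm_mulmx m k n (X : 'M[K]_(m, k)) (Y : 'M[K]_(k, n)) :
  `|X *m Y| <= k%:R * (`|X| * `|Y|).
Proof.
apply: mx_norm_le => [|i j]; first by rewrite !mulr_ge0 ?ler0n.
rewrite mxE (le_trans (ler_norm_sum _ _ _)) //.
rewrite -[k in k%:R]card_ord -sum1_card natr_sum mulr_suml ler_sum // => l _.
by rewrite mul1r normrM ler_pM ?ler_mx_entry_norm.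
Qed.

Lemma mx_norm_linear m n m' n' (p : {linear 'M[K]_(m, n) -> 'M[K]_(m', n')}) :
  exists2 c, 0 <= c & forall X, `|p X| <= c * `|X|.
Proof.
exists (\sum_i \sum_j `|p (delta_mx i j)|) => [|X].
  by rewrite sumr_ge0 // => i _; rewrite sumr_ge0.
rewrite {1}(matrix_sum_delta X) linear_sum mulr_suml (le_trans (ler_norm_sum _ _ _)) //.
apply: ler_sum => i _; rewrite linear_sum mulr_suml (le_trans (ler_norm_sum _ _ _)) //.
apply: ler_sum => j _; rewrite linearZ normrZ mulrC.
by rewrite ler_wpM2l ?ler_mx_entry_norm.
Qed.

End MatrixNorm.

(** * Entrywise calculus and the Gronwall lemma for matrices *)

Section MatrixPrimitive.
Variable K : realType.

Definition mx_primitive_ge0 m n (X dX : K -> 'M[K]_(m, n)) :=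
  forall i j, primitive_ge0 (fun t => X t i j) (fun t => dX t i j).

Lemma eq_mx_primitive_ge0 m n (X dX dY : K -> 'M[K]_(m, n)) :
  (forall t : K, 0 < t -> dX t = dY t) ->
  mx_primitive_ge0 X dX -> mx_primitive_ge0 X dY.
Proof.
move=> e h i j; have [X0 Xd] := h i j.
by split=> // t t0; rewrite -e //; exact: Xd.
Qed.

Lemma mx_primitive_ge0_cst m n (A : 'M[K]_(m, n)) :
  mx_primitive_ge0 (fun=> A) (fun=> 0).
Proof.
by move=> i j; apply: eq_primitive_ge0 (primitive_ge0_cst (A i j)) => // t; rewrite mxE.
Qed.

Lemma mx_primitive_ge0D m n (X Y dX dY : K -> 'M[K]_(m, n)) :
  mx_primitive_ge0 X dX -> mx_primitive_ge0 Y dY ->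
  mx_primitive_ge0 (fun t => X t + Y t) (fun t => dX t + dY t).
Proof.
move=> h k i j.
by apply: eq_primitive_ge0 (primitive_ge0D (h i j) (k i j)) => t; rewrite mxE.
Qed.

Lemma mx_primitive_ge0N m n (X dX : K -> 'M[K]_(m, n)) :
  mx_primitive_ge0 X dX -> mx_primitive_ge0 (fun t => - X t) (fun t => - dX t).
Proof.
by move=> h i j; apply: eq_primitive_ge0 (primitive_ge0N (h i j)) => t; rewrite mxE.
Qed.

Lemma mx_primitive_ge0B m n (X Y dX dY : K -> 'M[K]_(m, n)) :
  mx_primitive_ge0 X dX -> mx_primitive_ge0 Y dY ->
  mx_primitive_ge0 (fun t => X t - Y t) (fun t => dX t - dY t).
Proof. by move=> h k; exact/mx_primitive_ge0D/mx_primitive_ge0N. Qed.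

Lemma mx_primitive_ge0M m k n (X dX : K -> 'M[K]_(m, k)) (Y dY : K -> 'M[K]_(k, n)) :
  mx_primitive_ge0 X dX -> mx_primitive_ge0 Y dY ->
  mx_primitive_ge0 (fun t => X t *m Y t) (fun t => dX t *m Y t + X t *m dY t).
Proof.
move=> h h' i j.
have := primitive_ge0_sum (index_enum 'I_k) (fun l => primitive_ge0M (h i l) (h' l j)).
by apply: eq_primitive_ge0 => t; rewrite ?mxE // big_split.
Qed.

Lemma mx_primitive_ge0_tr m n (X dX : K -> 'M[K]_(m, n)) :
  mx_primitive_ge0 X dX -> mx_primitive_ge0 (fun t => (X t)^T) (fun t => (dX t)^T).
Proof. by move=> h i j; apply: eq_primitive_ge0 (h j i) => t; rewrite mxE. Qed.

Lemma mx_primitive_ge0_linear m n m' n' (p : {linear 'M[K]_(m, n) -> 'M[K]_(m', n')})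
    (X dX : K -> 'M[K]_(m, n)) :
  mx_primitive_ge0 X dX -> mx_primitive_ge0 (fun t => p (X t)) (fun t => p (dX t)).
Proof.
move=> h i j.
have pE Z : p Z i j = \sum_k \sum_l Z k l * p (delta_mx k l) i j.
  rewrite {1}(matrix_sum_delta Z) linear_sum summxE; apply: eq_bigr => k _.
  rewrite linear_sum summxE; apply: eq_bigr => l _.
  by rewrite linearZ mxE.
have := primitive_ge0_sum (index_enum 'I_m) (fun k =>
  primitive_ge0_sum (index_enum 'I_n) (fun l =>
  primitive_ge0M (h k l) (primitive_ge0_cst (p (delta_mx k l) i j)))).
apply: eq_primitive_ge0 => t; rewrite pE //.
by apply: eq_bigr => k _; apply: eq_bigr => l _; rewrite mulr0 addr0.
Qed.

Lemma mx_primitive_ge0_bounded m n (X dX : K -> 'M[K]_(m, n)) (T : K) :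
  mx_primitive_ge0 X dX ->
  exists2 M, 0 <= M & forall t : K, 0 <= t <= T -> `|X t| <= M.
Proof.
move=> h.
have /choice[M HM] : forall ij : 'I_m * 'I_n, exists M : K,
    0 <= M /\ forall t : K, 0 <= t <= T -> `|X t ij.1 ij.2| <= M.
  by move=> [i j]; have [M M0 HM] := primitive_ge0_bounded T (h i j); exists M.
have M0 i j : 0 <= M (i, j) by have [] := HM (i, j).
exists (\sum_i \sum_j M (i, j)) => [|t tT].
  by do 2! (rewrite sumr_ge0 // => ? _).
apply: mx_norm_le => [|i j]; first by do 2! (rewrite sumr_ge0 // => ? _).
apply: le_trans ((HM (i, j)).2 t tT) _.
rewrite (bigD1 i) //= (bigD1 j) //= -addrA lerDl addr_ge0 ?sumr_ge0 // => l _.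
by rewrite sumr_ge0.
Qed.

(** The scalar lemma is applied to the squared Frobenius norm [u], which is differentiable, unlike
    the maximum norm, and dominates its square. *)
Lemma mx_gronwall_eq0 m n (D G : K -> 'M[K]_(m, n)) (L T a : K) :
  0 <= L -> mx_primitive_ge0 D G -> (forall t : K, 0 < t < T -> `|G t| <= L * `|D t|) ->
  0 <= a <= T -> D a = 0 -> forall t : K, 0 <= t <= T -> D t = 0.
Proof.
move=> L0 DG GD aT Da t tT.
pose u s := \sum_i \sum_j D s i j * D s i j.
pose du s := \sum_i \sum_j (G s i j * D s i j + D s i j * G s i j).
have udu : primitive_ge0 u du.
  apply: primitive_ge0_sum => i; apply: primitive_ge0_sum => j.
  exact: primitive_ge0M.
have u0i s i : 0 <= \sum_j D s i j * D s i j.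
  by apply: sumr_ge0 => j _; rewrite -expr2 sqr_ge0.
have u0 s : 0 <= u s by exact: sumr_ge0.
have uD s i j : D s i j * D s i j <= u s.
  rewrite /u (bigD1 i) //= (bigD1 j) //= -addrA lerDl addr_ge0 ?sumr_ge0 // => l _.
  by rewrite -expr2 sqr_ge0.
have normD s : `|D s| * `|D s| <= u s.
  rewrite -expr2 -(sqr_sqrtr (u0 s)) lerXn2r ?nnegrE ?sqrtr_ge0 //.
  apply: mx_norm_le => [|i j]; first exact: sqrtr_ge0.
  by rewrite -sqrtr_sqr ler_wsqrtr // expr2.
(* Each of the [m * n] entries contributes two products, each bounded by [L * u s]. *)
have dule s : 0 < s < T ->
    `|du s| <= (m%:R * (n%:R * (2 * L))) * u s.
  move=> sT.
  have GDu i j : `|G s i j * D s i j| <= L * u s.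
    rewrite normrM.
    rewrite (le_trans (ler_pM _ _ (ler_mx_entry_norm _ i j) (ler_mx_entry_norm _ i j))) //.
    rewrite (le_trans (ler_wpM2r _ (GD s sT))) // -mulrA.
    by rewrite ler_wpM2l.
  have -> : m%:R * (n%:R * (2 * L)) * u s = \sum_(i < m) \sum_(j < n) (L * u s + L * u s).
    rewrite !sumr_const !card_ord -[RHS]mulr_natl -[X in _ = _ * X]mulr_natl.
    by move: (u s) => v; ring.
  rewrite (le_trans (ler_norm_sum _ _ _)) // ler_sum // => i _.
  rewrite (le_trans (ler_norm_sum _ _ _)) // ler_sum // => j _.
  by rewrite (le_trans (ler_normD _ _)) // lerD // mulrC.
have ut : u t = 0.
  apply: (gronwall_eq0 udu u0 dule aT) tT.
  by rewrite /u; do 2! (apply: big1 => ? _); rewrite Da mxE mulr0.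
apply/matrixP => i j; rewrite mxE; apply/eqP.
by have := uD t i j; rewrite ut -expr2 => h; rewrite -sqrf_eq0 eq_le h sqr_ge0.
Qed.

End MatrixPrimitive.

(** * Uniqueness for locally Lipschitz equations *)

Section Uniqueness.
Variables (K : realType) (n : nat).
Implicit Types F G : 'M[K]_n -> 'M[K]_n.

(** The constant depends on the ball because the Riccati fields are quadratic. *)
Definition ball_lipschitz F := forall M : K, exists2 L : K, 0 <= L &
  forall X Y, `|X| <= M -> `|Y| <= M -> `|F X - F Y| <= L * `|X - Y|.

Lemma ball_lipschitz_cst A : ball_lipschitz (fun=> A).
Proof. by move=> M; exists 0 => // X Y _ _; rewrite subrr normr0 mul0r. Qed.

Lemma ball_lipschitz_linear (p : {linear 'M[K]_n -> 'M[K]_n}) : ball_lipschitz p.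
Proof.
move=> M; have [c c0 hc] := mx_norm_linear p.
by exists c => // X Y _ _; rewrite -linearB.
Qed.

Lemma ball_lipschitz_id : ball_lipschitz id.
Proof. by move=> M; exists 1 => // X Y _ _; rewrite mul1r. Qed.

Lemma ball_lipschitzD F G : ball_lipschitz F -> ball_lipschitz G ->
  ball_lipschitz (fun X => F X + G X).
Proof.
move=> hF hG M; have [L L0 HL] := hF M; have [N N0 HN] := hG M.
exists (L + N) => [|X Y XM YM]; first exact: addr_ge0.
rewrite opprD addrACA mulrDl (le_trans (ler_normD _ _)) // lerD //.
  exact: HL.
exact: HN.
Qed.

Lemma ball_lipschitzN F : ball_lipschitz F -> ball_lipschitz (fun X => - F X).
Proof.
move=> hF M; have [L L0 HL] := hF M; exists L => // X Y XM YM.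
by rewrite -opprD normrN HL.
Qed.

Lemma ball_lipschitzM F G : ball_lipschitz F -> ball_lipschitz G ->
  ball_lipschitz (fun X => F X *m G X).
Proof.
move=> hF hG M; have [L L0 HL] := hF M; have [N N0 HN] := hG M.
(* On the ball, a Lipschitz map is bounded through its value at 0. Writing [|M|] keeps the constants
   nonnegative when [M < 0]. *)
have bnd H (c : K) : 0 <= c ->
    (forall X Y, `|X| <= M -> `|Y| <= M -> `|H X - H Y| <= c * `|X - Y|) ->
    forall X, `|X| <= M -> `|(H X : 'M[K]_n)| <= `|(H 0 : 'M[K]_n)| + c * `|M|.
  move=> c0 hH X XM; have M0 : 0 <= M by exact: le_trans XM.
  rewrite -[H X](subrK (H 0)) addrC (le_trans (ler_normD _ _)) // lerD2l.
  by rewrite (le_trans (hH _ _ XM _)) ?normr0 // subr0 ler_wpM2l // ger0_norm.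
pose b := n%:R * ((`|F 0| + L * `|M|) * N); pose c := n%:R * (L * (`|G 0| + N * `|M|)).
exists (b + c) => [|X Y XM YM].
  by rewrite addr_ge0 // !mulr_ge0 ?addr_ge0 ?mulr_ge0.
have -> : F X *m G X - F Y *m G Y = F X *m (G X - G Y) + (F X - F Y) *m G Y by mx_ring.
rewrite mulrDl (le_trans (ler_normD _ _)) // lerD // (le_trans (mx_norm_mulmx _ _)) //.
  by rewrite -!mulrA ler_wpM2l // ler_pM ?HN // bnd.
rewrite -!mulrA ler_wpM2l // [_ * `|X - Y|]mulrC mulrA ler_pM ?HL //; exact: bnd.
Qed.

(** On [[0, t]] both solutions stay in the ball of radius [a + b], where [F] is Lipschitz, so
    Gronwall applies to their difference. *)
Lemma ode_unique F (X Y : K -> 'M[K]_n) : ball_lipschitz F ->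
  mx_primitive_ge0 X (fun t => F (X t)) -> mx_primitive_ge0 Y (fun t => F (Y t)) ->
  X 0 = Y 0 -> forall t : K, 0 <= t -> X t = Y t.
Proof.
move=> hF hX hY XY0 t t0.
have [a a0 Xa] := mx_primitive_ge0_bounded t hX.
have [b b0 Yb] := mx_primitive_ge0_bounded t hY.
have [L L0 HL] := hF (a + b).
apply: subr0_eq.
apply: (@mx_gronwall_eq0 _ _ _ (fun t => X t - Y t) _ L t 0 L0 (mx_primitive_ge0B hX hY)).
- move=> s /andP[s0 st]; have ss : 0 <= s <= t by rewrite !ltW.
  apply: HL; first by rewrite (le_trans (Xa _ ss)) // lerDl.
  by rewrite (le_trans (Yb _ ss)) // lerDr.
- by rewrite lexx.
- by rewrite XY0 subrr.
- by rewrite t0 lexx.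
Qed.

Lemma solves_ode_primitive (F : K -> 'M[K]_n -> 'M[K]_n) X0 X :
  solves_ode F X0 X -> mx_primitive_ge0 X (fun t => F t (X t)).
Proof.
move=> [_ X_0 dX] i j; split=> [|t t0].
  have /continuous_cvg := @coord_continuous K n n i j (X 0).
  exact.
have [Xt <-] := dX t t0; rewrite derive_mx // mxE.
by apply: derivableP; have /derivable_mxP := Xt; exact.
Qed.

End Uniqueness.

(** * Inverse of a fundamental solution and sign of Lyapunov solutions *)

Section Inverse.
Variable K : realType.

(** Differentiation is local, so identities known only at positive times can be differentiated
    there. *)
Lemma primitive_ge0_unique (f g df dg : K -> K) :
  (forall t : K, 0 < t -> f t = g t) ->
  primitive_ge0 f df -> primitive_ge0 g dg -> forall t : K, 0 < t -> df t = dg t.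
Proof.
move=> fg [_ hf] [_ hg] t t0.
have [_ <-] := hf t t0; have [_ <-] := hg t t0.
apply: near_eq_derive.
near=> s; apply: fg; near: s; exact: lt_nbhsr.
Unshelve. all: by end_near. Qed.

Lemma primitive_ge0_det n (X dX : K -> 'M[K]_n) : mx_primitive_ge0 X dX ->
  exists d, primitive_ge0 (fun t => \det (X t)) d.
Proof.
move=> hX.
have /choice[d hd] : forall s : 'S_n, exists d, primitive_ge0 (fun t => \prod_i X t i (s i)) d.
  by move=> s; apply: (@primitive_ge0_prod _ _ _ _ (fun i t => dX t i (s i))) => i; exact: hX.
eexists; apply: primitive_ge0_sum => s; apply: primitive_ge0M (hd s).
exact: (primitive_ge0_cst ((-1) ^+ s)).
Qed.

(** Cramer's formula replaces [invmx], whose definition by cases would depend on invertibility at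
    negative times, where nothing is known. *)
Lemma mx_primitive_ge0_invmx n (X dX : K -> 'M[K]_n) : mx_primitive_ge0 X dX ->
  (forall t : K, 0 <= t -> X t \in unitmx) ->
  exists d, mx_primitive_ge0 (fun t => (\det (X t))^-1 *: \adj (X t)) d.
Proof.
move=> hX Xu.
have [d hd] := primitive_ge0_det hX.
have det0 (t : K) : 0 <= t -> \det (X t) != 0.
  by move=> t0; have := Xu t t0; rewrite unitmxE unitfE.
have [e he] := primitive_ge0V det0 hd.
have /choice[a ha] : forall ij : 'I_n * 'I_n, exists a,
    primitive_ge0 (fun t => cofactor (X t) ij.2 ij.1) a.
  move=> [i j] /=.
  have h : mx_primitive_ge0 (fun t => row' j (col' i (X t)))
                            (fun t => row' j (col' i (dX t))).
    by move=> k l; apply: eq_primitive_ge0 (hX _ _) => t; rewrite !mxE.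
  have [c hc] := primitive_ge0_det h.
  by eexists; exact: primitive_ge0M (primitive_ge0_cst _) hc.
exists (fun t => \matrix_(i, j) (e t * \adj (X t) i j + (\det (X t))^-1 * a (i, j) t)).
move=> i j; apply: eq_primitive_ge0 (primitive_ge0M he (ha (i, j))) => t /=.
  by rewrite !mxE.
by rewrite !mxE.
Qed.

Lemma lyapunov_psd n (M G D E : K -> 'M[K]_n) :
  (forall T : K, exists2 c : K, 0 <= c & forall t : K, 0 <= t <= T -> `|M t| <= c) ->
  mx_primitive_ge0 E (fun t => M t *m E t) -> E 0 = 1%:M ->
  mx_primitive_ge0 D (fun t => M t *m D t + D t *m (M t)^T + G t) -> D 0 = 0 ->
  (forall t : K, 0 <= t -> (D t)^T = D t) -> (forall t : K, 0 < t -> psd (G t)) ->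
  forall t : K, 0 <= t -> psd (D t).
Proof.
move=> Mb hE E0 hD D0 symD psdG.
(* For [N] the cokernel of [E t], the function [E s *m N] solves a linear equation and vanishes at
   [s = t]. Gronwall run backwards gives [N = E 0 *m N = 0]. *)
have Eu (t : K) : 0 <= t -> E t \in unitmx.
  move=> t0; rewrite -row_full_unit -cokermx_eq0; apply/eqP.
  set N := cokermx _; rewrite -[LHS]mul1mx -E0.
  have [c c0 Mc] := Mb t.
  have hEN : mx_primitive_ge0 (fun s => E s *m N) (fun s => M s *m (E s *m N)).
    have := mx_primitive_ge0M hE (mx_primitive_ge0_cst N).
    by apply: eq_mx_primitive_ge0 => s _; rewrite mulmx0 addr0 mulmxA.
  apply: (@mx_gronwall_eq0 _ _ _ _ _ (n%:R * c) t t _ hEN).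
  - by rewrite mulr_ge0.
  - move=> s /andP[s0 st]; rewrite (le_trans (mx_norm_mulmx _ _)) // -mulrA.
    by rewrite ler_wpM2l // ler_wpM2r // Mc // !ltW.
  - by rewrite t0 lexx.
  - exact: mulmx_coker.
  - by rewrite lexx t0.
have [dF hF] := mx_primitive_ge0_invmx hE Eu.
move: hF; set F := fun t => _ *: _ => hF.
have FE (t : K) : 0 <= t -> F t *m E t = 1%:M.
  by move=> t0; have := Eu t t0 => u; rewrite -(mulVmx u) /invmx u.
have EF (t : K) : 0 <= t -> E t *m F t = 1%:M.
  by move=> t0; apply: mulmx1C; exact: FE.
have dFE (t : K) : 0 < t -> dF t = - (F t *m M t).
  move=> t0; have : dF t *m E t + F t *m (M t *m E t) = 0.
    apply/matrixP => i j.
    apply: (primitive_ge0_unique _ (mx_primitive_ge0M hF hE i j)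
      (mx_primitive_ge0_cst 1%:M i j)) t0 => s s0.
    by rewrite FE // ltW.
  move/(congr1 (fun X => X *m F t)); rewrite mul0mx mulmxDl -!mulmxA EF ?ltW //.
  by rewrite !mulmx1 => /eqP; rewrite addr_eq0 => /eqP.
(* [F] inverts [E], so the terms in [M] cancel in the derivative of [U] and only the congruence of
   [G] remains. *)
pose U s := F s *m D s *m (F s)^T.
have hU : mx_primitive_ge0 U (fun s => F s *m G s *m (F s)^T).
  have := mx_primitive_ge0M (mx_primitive_ge0M hF hD) (mx_primitive_ge0_tr hF).
  apply: eq_mx_primitive_ge0 => s s0; rewrite dFE //.
  rewrite linearN /= trmx_mul.
  by move: (F s)^T (M s)^T => F' M'; mx_ring.
move=> t t0; split=> [|y]; first exact: symD.
have DU : D t = E t *m U t *m (E t)^T.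
  rewrite /U !mulmxA EF // mul1mx -mulmxA -trmx_mul EF //.
  by rewrite trmx1 mulmx1.
(* The vector [x] is frozen at time [t], so that [x^T *m U s *m x] is a scalar function of [s]
   alone, nondecreasing from 0. *)
pose x := (E t)^T *m y.
have -> : y^T *m D t *m y = x^T *m U t *m x.
  by rewrite DU /x trmx_mul trmxK !mulmxA.
have hx : mx_primitive_ge0 (fun s => x^T *m U s *m x)
    (fun s => x^T *m (F s *m G s *m (F s)^T) *m x).
  have := mx_primitive_ge0M (mx_primitive_ge0M (mx_primitive_ge0_cst x^T) hU)
    (mx_primitive_ge0_cst x).
  by apply: eq_mx_primitive_ge0 => s _; rewrite mul0mx add0r mulmx0 addr0.
have := primitive_ge0_homo (hx 0 0) (lexx 0) t0.
rewrite /U D0 mulmx0 mul0mx mulmx0 mul0mx [X in X <= _]mxE; apply=> s /andP[s0 _].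
have [_ /(_ ((F s)^T *m x))] := psdG s s0.
by rewrite trmx_mul trmxK !mulmxA.
Qed.

End Inverse.

(** * Riccati equations *)

Section PositiveDefinite.
Variable K : realType.

Lemma psd_congr m n (B : 'M[K]_(m, n)) (Q : 'M[K]_m) : psd Q -> psd (B^T *m Q *m B).
Proof.
move=> [symQ posQ]; split=> [|x]; first by rewrite !trmx_mul trmxK symQ mulmxA.
by have := posQ (B *m x); rewrite trmx_mul !mulmxA.
Qed.

(** A nonzero column of [cokermx Q] would be killed by [Q], and the quadratic form would vanish on
    it. *)
Lemma posdef_unitmx n (Q : 'M[K]_n) : posdef Q -> Q \in unitmx.
Proof.
move=> [_ posQ]; rewrite -row_full_unit -cokermx_eq0; apply/eqP/matrixP => i j.
rewrite [RHS]mxE; apply/eqP/negP => /negP ne0.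
have /posQ : col j (cokermx Q) != 0.
  by apply: contra ne0 => /eqP/matrixP/(_ i 0); rewrite !mxE => ->.
by rewrite colE -mulmxA (mulmxA Q) mulmx_coker mul0mx mulmx0 mxE ltxx.
Qed.

Lemma posdef_psd_inv n (Q : 'M[K]_n) : posdef Q -> psd (invmx Q).
Proof.
move=> pdQ; have Qu := posdef_unitmx pdQ; have [symQ posQ] := pdQ.
have -> : invmx Q = (invmx Q)^T *m Q *m invmx Q.
  by rewrite -mulmxA mulmxV // mulmx1 trmx_inv symQ.
apply: psd_congr; split=> // x; have [->|/posQ/ltW //] := eqVneq x 0.
by rewrite mulmx0 mxE.
Qed.

End PositiveDefinite.

(** * The Riccati vector fields *)

Section Riccati.
Variables (K : realType) (n : nat) (A R S : 'M[K]_n).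

Lemma ricc_ball_lipschitz : ball_lipschitz (ricc A R S).
Proof.
apply: ball_lipschitzD (ball_lipschitz_cst R).
apply: ball_lipschitzD; last apply: ball_lipschitzN.
  apply: ball_lipschitzD; apply: ball_lipschitzM;
    solve [exact: ball_lipschitz_id | exact: ball_lipschitz_cst].
apply: ball_lipschitzM (ball_lipschitz_id _).
exact: ball_lipschitzM (ball_lipschitz_id _) (ball_lipschitz_cst _).
Qed.

Lemma ricc_pi_ball_lipschitz (p : {linear 'M[K]_n -> 'M[K]_n}) :
  ball_lipschitz (ricc_pi p A R S).
Proof.
have hp := ball_lipschitz_linear p.
have hpS := ball_lipschitzM hp (ball_lipschitz_cst S).
have hid := @ball_lipschitz_id K n.
have hM : ball_lipschitz (fun Q => A - p Q *m S).
  exact: ball_lipschitzD (ball_lipschitz_cst A) (ball_lipschitzN hpS).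
have hM' : ball_lipschitz (fun Q => (A - p Q *m S)^T).
  move=> M; have [L L0 HL] := hM M; have [c c0 Hc] := mx_norm_linear (@trmx K n n).
  exists (c * L) => [|X Y XM YM]; first exact: mulr_ge0.
  by rewrite -linearB (le_trans (Hc _)) // -mulrA ler_wpM2l // HL.
apply: ball_lipschitzD; last exact: ball_lipschitzM.
apply: ball_lipschitzD (ball_lipschitz_cst R).
by apply: ball_lipschitzD; apply: ball_lipschitzM.
Qed.

Hypothesis symR : R^T = R.
Hypothesis symS : S^T = S.

Lemma ricc_tr Q : (ricc A R S Q)^T = ricc A R S Q^T.
Proof.
rewrite /ricc 2!linearD linearN linearD /= !trmx_mul trmxK symR symS.
by congr (_ - _ + _); [exact: addrC|rewrite mulmxA].
Qed.

(** The transpose solves the same equation from the same initial value. *)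
Lemma ricc_solution_sym X : mx_primitive_ge0 X (fun t => ricc A R S (X t)) ->
  (X 0)^T = X 0 -> forall t : K, 0 <= t -> (X t)^T = X t.
Proof.
move=> hX X0 t t0.
apply: (@ode_unique _ _ (ricc A R S) (fun t => (X t)^T) X) t0 => //.
  exact: ricc_ball_lipschitz.
by apply: eq_mx_primitive_ge0 (mx_primitive_ge0_tr hX) => s _; rewrite ricc_tr.
Qed.

Lemma ricc_pi_fixed (p : {linear 'M[K]_n -> 'M[K]_n}) Q : Q^T = Q -> p Q = Q ->
  ricc_pi p A R S Q = ricc A R S Q.
Proof.
move=> symQ pQ; rewrite /ricc_pi /ricc pQ linearB /= trmx_mul symQ symS.
by move: A^T => A'; mx_ring.
Qed.

(** Completing the square in [P] around [p Z]; the quadratic remainder is the positive semi-definite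
    source in the comparison of the two flows. *)
Lemma ricc_pi_sub (p : {linear 'M[K]_n -> 'M[K]_n}) Z P : (p Z)^T = p Z ->
  ricc_pi p A R S Z - ricc A R S P =
  (A - p Z *m S) *m (Z - P) + (Z - P) *m (A - p Z *m S)^T
    + (P - p Z) *m S *m (P - p Z).
Proof.
move=> symZ; rewrite /ricc_pi /ricc linearB /= trmx_mul symZ symS.
by move: A^T (p Z) => A' X; mx_ring.
Qed.

End Riccati.

(** * Riccati flows and the projection *)

Section ProjectedRiccati.
Variables (K : realType) (n : nat) (A R S : 'M[K]_n) (p : {linear 'M[K]_n -> 'M[K]_n}).
Hypothesis symR : R^T = R.
Hypothesis psdS : psd S.
Hypothesis p_pos : positive_map p.
Hypothesis p_idem : forall X, p (p X) = p X.
Hypothesis p_mul : forall X Y, p X = X -> p Y = Y -> p (X *m Y) = X *m Y.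
Hypothesis p_proj : forall X B, p B = B ->
  p (B *m (X - p X) + (X - p X) *m B) = 0.
Hypothesis pA : p A = A.
Hypothesis pA' : p A^T = A^T.
Hypothesis pR : p R = R.
Hypothesis pS : p S = S.

Let symS : S^T = S. Proof. by case: psdS. Qed.

Lemma ricc_stable Q : p Q = Q -> p (ricc A R S Q) = ricc A R S Q.
Proof.
move=> pQ; rewrite /ricc 2!linearD linearN linearD /=.
by rewrite pR !p_mul // p_mul.
Qed.

(** The derivative of [v - p v] is zero by idempotence, so [v] stays in the range of [p]. There the
    projected field is the Riccati field itself, and uniqueness concludes. *)
Lemma projected_flow_eq v X :
  mx_primitive_ge0 v (fun t => p (ricc A R S (v t))) ->
  mx_primitive_ge0 X (fun t => ricc A R S (X t)) ->
  v 0 = X 0 -> p (X 0) = X 0 ->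
  forall t : K, 0 <= t -> v t = X t /\ p (X t) = X t.
Proof.
move=> hv hX v0 pX0.
have pv (t : K) : 0 <= t -> p (v t) = v t.
  move=> t0; apply/esym/subr0_eq.
  have hD := mx_primitive_ge0B hv (mx_primitive_ge0_linear p hv).
  apply: (@mx_gronwall_eq0 _ _ _ (fun t => v t - p (v t)) _ 0 t 0 (lexx 0) hD).
  - by move=> s _; rewrite p_idem subrr normr0 mul0r.
  - by rewrite lexx.
  - by rewrite v0 pX0 subrr.
  - by rewrite t0 lexx.
have vX (t : K) : 0 <= t -> v t = X t.
  apply: (ode_unique (@ricc_ball_lipschitz _ _ A R S) _ hX v0).
  by apply: eq_mx_primitive_ge0 hv => s s0; rewrite ricc_stable // pv // ltW.
by move=> t t0; rewrite -vX // pv.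
Qed.

(** * The flow [Z] from [Q] against the Riccati flow [X] from [p Q] *)

Section Comparison.
Variables (X Z E : K -> 'M[K]_n) (Q : 'M[K]_n).
Hypothesis hX : mx_primitive_ge0 X (fun t => ricc A R S (X t)).
Hypothesis hZ : mx_primitive_ge0 Z (fun t => ricc_pi p A R S (Z t)).
Hypothesis hE : mx_primitive_ge0 E (fun t => (A - X t *m S) *m E t).
Hypothesis E0 : E 0 = 1%:M.
Hypothesis symQ : Q^T = Q.
Hypothesis Z0 : Z 0 = Q.
Hypothesis X0 : X 0 = p Q.
Hypothesis pX : forall t : K, 0 <= t -> p (X t) = X t.

Let M t := A - X t *m S.
(** The candidate for [Z t - X t]. *)
Let W t := E t *m (Q - p Q) *m (E t)^T.

Let symX (t : K) : 0 <= t -> (X t)^T = X t.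
Proof.
apply: (ricc_solution_sym symR symS hX).
by rewrite X0; exact: positive_map_sym.
Qed.

Let pM (t : K) : 0 <= t -> p (M t) = M t.
Proof. by move=> t0; rewrite linearB /= pA p_mul ?pX. Qed.

Let pM' (t : K) : 0 <= t -> p (M t)^T = (M t)^T.
Proof.
by move=> t0; rewrite linearB /= trmx_mul symX // symS linearB /= pA' p_mul ?pX.
Qed.

Let hM : exists dM, mx_primitive_ge0 M dM.
Proof.
eexists; apply: mx_primitive_ge0B (mx_primitive_ge0_cst A) _.
exact: mx_primitive_ge0M hX (mx_primitive_ge0_cst S).
Qed.

Let symW t : (W t)^T = W t.
Proof.
rewrite /W !trmx_mul trmxK linearB /= symQ (positive_map_sym p_pos symQ).
by rewrite mulmxA.
Qed.

Let hW : mx_primitive_ge0 W (fun t => M t *m W t + W t *m (M t)^T).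
Proof.
have := mx_primitive_ge0M (mx_primitive_ge0M hE (mx_primitive_ge0_cst (Q - p Q)))
  (mx_primitive_ge0_tr hE).
apply: eq_mx_primitive_ge0 => t _.
by rewrite mulmx0 addr0 trmx_mul -/(M t) /W !mulmxA.
Qed.

(** By [proj_lyapunov], [p W] solves the same linear equation as [W], but from [p (Q - p Q) = 0].
    The Gronwall constant adds bounds for [M] and its transpose, each times [n] for the product
    norm. *)
Let pW (t : K) : 0 <= t -> p (W t) = 0.
Proof.
move=> t0; have [dM hdM] := hM.
have [c c0 hc] := mx_primitive_ge0_bounded t hdM.
have [d d0 hd] := mx_primitive_ge0_bounded t (mx_primitive_ge0_tr hdM).
have hV : mx_primitive_ge0 (fun s => p (W s))
    (fun s => M s *m p (W s) + p (W s) *m (M s)^T).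
  apply: eq_mx_primitive_ge0 (mx_primitive_ge0_linear p hW) => s /ltW s0.
  by rewrite (proj_lyapunov p_pos p_idem p_mul p_proj) ?pM ?pM'.
apply: (@mx_gronwall_eq0 _ _ _ (fun s => p (W s)) _ (n%:R * c + n%:R * d) t 0 _ hV).
- by rewrite addr_ge0 ?mulr_ge0.
- move=> s /andP[s0 st]; have ss : 0 <= s <= t by rewrite !ltW.
  rewrite (le_trans (ler_normD _ _)) // mulrDl lerD // (le_trans (mx_norm_mulmx _ _)) //.
    by rewrite -mulrA ler_wpM2l // ler_wpM2r // hc.
  by rewrite -[leRHS]mulrA [d * _]mulrC ler_wpM2l // ler_wpM2l // hd.
- by rewrite lexx.
- by rewrite /W E0 trmx1 mulmx1 mul1mx linearB /= p_idem subrr.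
- by rewrite t0 lexx.
Qed.

(** Since [p (X + W) = X], the field [ricc_pi] at [X + W] is [ricc] at [X] plus the Lyapunov
    operator at [W]. Hence [X + W] solves the equation of [Z]. *)
Lemma ricc_pi_solutionE (t : K) : 0 <= t ->
  Z t = X t + E t *m (Q - p Q) *m (E t)^T.
Proof.
apply: (ode_unique (@ricc_pi_ball_lipschitz _ _ A R S p) hZ (Y := fun t => X t + W t)).
  apply: eq_mx_primitive_ge0 (mx_primitive_ge0D hX hW) => s /ltW s0.
  have pXW : p (X s + W s) = X s by rewrite linearD /= pX // pW // addr0.
  rewrite /ricc_pi pXW -/(M s) /ricc /M.
  rewrite linearB /= trmx_mul symX // symS.
  by move: A^T (W s) => A' V; mx_ring.
by rewrite /W E0 trmx1 mulmx1 mul1mx Z0 X0 addrC subrK.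
Qed.

(** As [p Z = X], completing the square gives [Z - Y] the drift [M], whose fundamental solution is
    [E], and the source [(Y - X) S (Y - X)]. *)
Lemma ricc_le_ricc_pi Y : mx_primitive_ge0 Y (fun t => ricc A R S (Y t)) ->
  Y 0 = Q -> forall t : K, 0 <= t -> loewner_le (Y t) (Z t).
Proof.
move=> hY Y0.
have pZ (s : K) : 0 <= s -> p (Z s) = X s.
  by move=> s0; rewrite ricc_pi_solutionE // linearD /= pX // pW // addr0.
have symY : forall t : K, 0 <= t -> (Y t)^T = Y t.
  by apply: (ricc_solution_sym symR symS hY); rewrite Y0.
apply: (@lyapunov_psd _ _ M (fun s => (Y s - X s) *m S *m (Y s - X s)) (fun s => Z s - Y s) E).
- by move=> T; have [dM hdM] := hM; exact: mx_primitive_ge0_bounded hdM.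
- exact: hE.
- exact: E0.
- apply: eq_mx_primitive_ge0 (mx_primitive_ge0B hZ hY) => s /ltW s0.
  by rewrite ricc_pi_sub ?pZ ?symX.
- by rewrite Z0 Y0 subrr.
- by move=> s s0; rewrite linearB /= symY // ricc_pi_solutionE // linearD /= symX // symW.
- move=> s /ltW s0; have symYX : (Y s - X s)^T = Y s - X s.
    by rewrite linearB /= symY // symX.
  by have := psd_congr (Y s - X s) psdS; rewrite symYX.
Qed.

End Comparison.

End ProjectedRiccati.

Theorem theorem2p12 (K : realType) (r r' : nat)
    (A : 'M[K]_r) (C : 'M[K]_(r', r)) (R : 'M[K]_r) (Sigma : 'M[K]_r')
    (S : 'M[K]_r)
    (hR : posdef R) (hSigma : posdef Sigma)
    (hS : S = C^T *m invmx Sigma *m C)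
    (hctrl : controllable A (psd_sqrt R)) (hobs : observable A C)
    (calB : set 'M[K]_r) (hB : matrix_ring calB)
    (pi : {linear 'M[K]_r -> 'M[K]_r})
    (hpos : positive_map pi)
    (hidem : pi \o pi =1 pi)
    (hrange : range pi = calB)
    (hproj : forall Q B : 'M[K]_r, calB B ->
       pi (B *m (Q - pi Q) + (Q - pi Q) *m B) = 0)
    (hA : calB A) (hA' : calB A^T) (hRB : calB R) (hSB : calB S)
    (phi phipi varphipi E : K -> 'M[K]_r -> 'M[K]_r)
    (hphi : flow_on (@psd K r) (ricc A R S) phi)
    (hphipi : flow_on (@psd K r) (ricc_pi pi A R S) phipi)
    (hvarphipi : flow_on (@psd K r `&` calB) (pi \o ricc A R S) varphipi)
    (hE : forall Q : 'M[K]_r, psd Q ->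
       solves_ode (fun t X => (A - phi t Q *m S) *m X) 1%:M (E ^~ Q)) :
  [/\ {in @psd K r, pi \o ricc A R S \o pi =1 ricc_pi pi A R S \o pi},
      {in @psd K r, ricc_pi pi A R S \o pi =1 ricc A R S \o pi} &
      {in @psd K r, ricc A R S \o pi =1 pi \o ricc_pi pi A R S \o pi}] /\
  (forall t : K, 0 <= t ->
    [/\ {in @psd K r, pi \o phi t \o pi =1 pi \o varphipi t \o pi},
        {in @psd K r, pi \o varphipi t \o pi =1 varphipi t \o pi},
        {in @psd K r, varphipi t \o pi =1 phi t \o pi} &
        {in @psd K r, phi t \o pi =1 phipi t \o pi}]) /\
  (forall (Q : 'M[K]_r) (t : K), psd Q -> 0 <= t ->
    loewner_le (phi t Q) (phipi t Q) /\
    phipi t Q = phi t (pi Q) + E t (pi Q) *m (Q - pi Q) *m (E t (pi Q))^T).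
Proof.
have p_idem X : pi (pi X) = pi X by exact: hidem.
(* [calB] is exactly the set of fixed points of [pi], the form used in all the lemmas. *)
have inB X : calB X -> pi X = X by rewrite -hrange => -[Y _ <-].
have Bfix X : pi X = X -> calB X by move=> <-; rewrite -hrange; exists X.
have p_mul X Y : pi X = X -> pi Y = Y -> pi (X *m Y) = X *m Y.
  by case: hB => _ _ BM /Bfix BX /Bfix BY; apply/inB/BM.
have p_proj X B : pi B = B -> pi (B *m (X - pi X) + (X - pi X) *m B) = 0.
  by move=> /Bfix; exact: hproj.
have symR : R^T = R by case: hR.
have psdS : psd S by rewrite hS; apply/psd_congr/posdef_psd_inv.
have symS : S^T = S by case: psdS.
have [pA pA' pR pS] := And4 (inB _ hA) (inB _ hA') (inB _ hRB) (inB _ hSB).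
have stable X : pi X = X -> pi (ricc A R S X) = ricc A R S X.
  exact: ricc_stable.
have ricc_piE Q : psd Q -> ricc_pi pi A R S (pi Q) = ricc A R S (pi Q).
  by move=> /hpos[symQ _]; exact: ricc_pi_fixed.
split.
  split=> Q /[!inE] psdQ /=.
  - by rewrite ricc_piE // stable.
  - by rewrite ricc_piE.
  - by rewrite ricc_piE // stable.
have flow0 Q : psd Q -> phi 0 Q = Q /\ phipi 0 Q = Q.
  by move=> psdQ; have [] := hphi Q psdQ; have [] := hphipi Q psdQ.
have flows Q : psd Q -> forall t : K, 0 <= t ->
    [/\ varphipi t (pi Q) = phi t (pi Q), pi (phi t (pi Q)) = phi t (pi Q)
      & phi t (pi Q) = phipi t (pi Q)].
  move=> psdQ; have psdP := hpos Q psdQ.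
  have hX := solves_ode_primitive (hphi _ psdP).
  (* The flow [varphipi] is specified only from positive semi-definite matrices in [calB], so
     membership of [pi Q] must be supplied. *)
  have BP : calB (pi Q) by exact: Bfix.
  have hv := solves_ode_primitive (hvarphipi _ (conj psdP BP)).
  have [v0 _ _] := hvarphipi _ (conj psdP BP).
  have [X0 Z0] := flow0 _ psdP.
  have v0X0 : varphipi 0 (pi Q) = phi 0 (pi Q) by rewrite X0.
  have pX0 : pi (phi 0 (pi Q)) = phi 0 (pi Q) by rewrite X0.
  have vX := projected_flow_eq p_idem p_mul pA pA' pR pS hv hX v0X0 pX0.
  move=> t t0; have [-> pX] := vX t t0; split=> //.
  (* Along [phi s (pi Q)], symmetric and fixed by [pi], the fields [ricc] and [ricc_pi] agree, so
     this curve also solves the equation of [phipi]. *)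
  apply: (ode_unique (X := fun s => phi s (pi Q)) (@ricc_pi_ball_lipschitz _ _ A R S pi) _
    (solves_ode_primitive (hphipi _ psdP)) _ t0); last by rewrite X0 Z0.
  apply: (eq_mx_primitive_ge0 _ hX) => s /ltW s0; rewrite ricc_pi_fixed //.
    by apply: (ricc_solution_sym symR symS hX) s0; rewrite X0; case: psdP.
  by have [] := vX s s0.
split=> [t t0|Q t psdQ t0].
  by split=> Q /[!inE] psdQ /=; have [e1 e2 e3] := flows Q psdQ t t0; rewrite ?e1 ?e2 -?e3.
have psdP := hpos Q psdQ.
have hX := solves_ode_primitive (hphi _ psdP).
have hY := solves_ode_primitive (hphi _ psdQ).
have hZ := solves_ode_primitive (hphipi _ psdQ).
have hEP := solves_ode_primitive (hE _ psdP).
have [E0 _ _] := hE _ psdP.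
have [Y0 Z0] := flow0 _ psdQ; have [X0 _] := flow0 _ psdP.
have symQ : Q^T = Q by case: psdQ.
have pX s : 0 <= s -> pi (phi s (pi Q)) = phi s (pi Q).
  by move=> s0; have [] := flows Q psdQ s s0.
split.
  exact: (ricc_le_ricc_pi symR psdS hpos p_idem p_mul p_proj pA pA' pS
    hX hZ hEP E0 symQ Z0 X0 pX hY Y0 t0).
exact: (ricc_pi_solutionE symR psdS hpos p_idem p_mul p_proj pA pA' pS
  hX hZ hEP E0 symQ Z0 X0 pX t0).
Qed.
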